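(* For every singular cardinal $\lambda$ of countable cofinality there is a $(\lambda,\lambda^+)$-graph of type $T_\lambda$ that does not have an $(\aleph_0,\lambda^+)$-subgraph.
   Context: For infinite cardinals $\lambda<\kappa$, a $(\lambda,\kappa)$-graph is a bipartite graph with bipartition $(A,B)$, $|A|=\lambda$, $|B|=\kappa$, in which every $b\in B$ has infinitely many neighbours in $A$. An $(\lambda',\kappa)$-subgraph of it is a subgraph with bipartition $(C,D)$, $C\subseteq A$, $D\subseteq B$, that is itself a $(\lambda',\kappa)$-graph. For a cardinal $\lambda$, $T_\lambda$ is the order tree of all sequences of elements of $\lambda$ of length at most $\omega$ (including the empty sequence), ordered by initial segment; $T_\lambda^{<\omega}$ consists of the finite sequences and $T_\lambda^\omega$ of the $\omega$-sequences. For $\kappa>\lambda$, the down-closure $T$ of a $\kappa$-sized set $X\subseteq T_\lambda^\omega$ is a $\lambda$-tree with $\kappa$ tops (the tops being the elements of $X$). A $T$-graph is a graph with vertex set $T$ in which the endvertices of every edge are comparable and for every $t$ the neighbours of $t$ below $t$ are cofinal in $\{s : s<t\}$. A $(\lambda,\kappa)$-graph of type $T_\lambda$ is the bipartite graph with bipartition classes $T^{<\omega}$ and $X$ formed by the edges between these sets of some $T$-graph, where $T$ is a $\lambda$-tree with $\kappa$ tops $X$. *)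

(* Defs.v *)
(* cardinals are represented by types, compared via injections. *)
From Stdlib Require Import List.
Import ListNotations.

Set Implicit Arguments.

Definition card_le (A B : Type) : Prop := exists f : A -> B, forall x y, f x = f y -> x = y.
Definition card_eq (A B : Type) : Prop :=
  exists (f : A -> B) (g : B -> A), (forall x, g (f x) = x) /\ (forall y, f (g y) = y).
Definition card_lt (A B : Type) : Prop := card_le A B /\ ~ card_le B A.

Definition finite_type (A : Type) : Prop := exists l : list A, forall x, In x l.
Definition infinite_type (A : Type) : Prop := ~ finite_type A.

(** [L] has the cardinality of a singular cardinal of countable cofinality:
    it is uncountable and is the union of countably many subsets each of
    strictly smaller cardinality (i.e. cf(|L|) = omega < |L|). *)
Definition singular_countable_cof (L : Type) : Prop :=
  ~ card_le L nat /\
  exists A : nat -> L -> Prop,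
    (forall x, exists n, A n x) /\ (forall n, card_lt {x : L | A n x} L).

Definition is_successor_card (L K : Type) : Prop :=
  card_lt L K /\
  forall Y : K -> Prop, card_le {y : K | Y y} L \/ card_le K {y : K | Y y}.

Definition lk_graph (Lam Kap VA VB : Type) (A : VA -> Prop) (B : VB -> Prop)
  (E : VA -> VB -> Prop) : Prop :=
  card_eq {a : VA | A a} Lam /\ card_eq {b : VB | B b} Kap /\
  forall b, B b -> infinite_type {a : VA | A a /\ E a b}.

Definition has_aleph0_subgraph (Kap VA VB : Type) (A : VA -> Prop) (B : VB -> Prop)
  (E : VA -> VB -> Prop) : Prop :=
  exists (C : VA -> Prop) (D : VB -> Prop) (E' : VA -> VB -> Prop),
    (forall a, C a -> A a) /\ (forall b, D b -> B b) /\
    (forall a b, E' a b -> E a b) /\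
    lk_graph nat Kap C D E'.

Inductive tnode (L : Type) : Type :=
| Fin : list L -> tnode L
| Inf : (nat -> L) -> tnode L.
Arguments Fin {L} _.
Arguments Inf {L} _.

Definition prefix_of (L : Type) (s : list L) (f : nat -> L) : Prop :=
  s = map f (seq 0 (length s)).

Definition tlt (L : Type) (u v : tnode L) : Prop :=
  match u, v with
  | Fin s, Fin t => exists w, w <> [] /\ t = s ++ w
  | Fin s, Inf f => prefix_of s f
  | Inf _, _ => False
  end.

Definition tle (L : Type) (u v : tnode L) : Prop := u = v \/ tlt u v.

Definition comparable (L : Type) (u v : tnode L) : Prop := tle u v \/ tle v u.

Definition downclosure (L : Type) (X : (nat -> L) -> Prop) (u : tnode L) : Prop :=
  match u with
  | Fin s => exists f, X f /\ prefix_of s f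
  | Inf f => X f
  end.

Definition T_graph (L : Type) (X : (nat -> L) -> Prop) (G : tnode L -> tnode L -> Prop) : Prop :=
  (forall u v, G u v -> downclosure X u /\ downclosure X v) /\
  (forall u v, G u v -> G v u) /\
  (forall u, ~ G u u) /\
  (forall u v, G u v -> comparable u v) /\
  (forall t, downclosure X t ->
     forall s, tlt s t -> exists r, tle s r /\ tlt r t /\ G r t).

Definition Tfin (L : Type) (X : (nat -> L) -> Prop) (s : list L) : Prop :=
  downclosure X (Fin s).
Definition Tedge (L : Type) (G : tnode L -> tnode L -> Prop) (s : list L) (f : nat -> L) : Prop :=
  G (Fin s) (Inf f).

Definition graph_of_type_T (L K : Type) (X : (nat -> L) -> Prop)
  (G : tnode L -> tnode L -> Prop) : Prop :=
  card_eq {f : nat -> L | X f} K /\ T_graph X G /\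
  lk_graph L K (Tfin X) X (Tedge G).

(* Main.v *)
(** Well-order [K], of cardinality [lambda^+], with initial segments of size at
    most [lambda], and approximate the order by increasing transitive relations
    [A n], each with initial segments of size less than [lambda].  Colour [K]
    greedily with [lambda] colours so that [A n]-related points get distinct
    colours; the colours of [a] for all [n] form the branch [F a], and the graph
    joins every branch to all of its finite initial segments.  Countably many
    nodes of a hypothetical [(aleph_0, lambda^+)]-subgraph leave only countably
    many values for each coordinate of [lambda^+] many branches.  This is
    impossible once every set of [lambda^+] indices contains an uncountable
    [A n]-chain for some [n].

    Such chains come from Shelah's argument for the existence of scales.  The
    relations [A n] can be arranged so that every point [a] of cofinality
    [omega_3] lies above a club of [a].  Given a large index set [U], build an
    [omega_3]-sequence in [K] that anticipates all initial segments of a club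
    guessing family; its limit [a] reflects an uncountable guessed set [C], and
    between consecutive points of [C] one finds elements of [U] forming a chain
    on an uncountable subset. *)
From mathcomp Require Import ssreflect ssrfun ssrbool eqtype boolp wochoice.
From Stdlib Require Import List Lia Wellfounded Relations Cantor.
From Stdlib Require Import Classical ClassicalEpsilon FunctionalExtensionality.
From Stdlib Require Import ProofIrrelevance.
Require Import Defs.

Set Implicit Arguments.
Unset Strict Implicit.

(** * Strict well-orders and well-founded recursion *)

Record strict_well_order (T : Type) (lt : T -> T -> Prop) : Prop := {
  swo_wf : well_founded lt;
  swo_trans : forall x y z, lt x y -> lt y z -> lt x z;
  swo_total : forall x y, lt x y \/ x = y \/ lt y x }.

Lemma well_ordering (T : Type) : exists lt : T -> T -> Prop, strict_well_order lt.
Proof.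
have [R wo] := well_ordering_principle {classic T}.
have least (P : T -> Prop) : ex P -> exists2 z, P z & forall x, P x -> R z x.
  move=> [x Px].
  have /wo[z [[]]] : nonempty (fun x : {classic T} => asbool (P x)).
    by exists x; apply/asboolP.
  rewrite unfold_in => /asboolP Pz lbz _.
  by exists z => // y Py; apply: lbz; rewrite unfold_in; apply/asboolP.
have tot (x y : T) : R x y \/ R y x.
  have [z zxy zmin] := least (fun z => z = x \/ z = y) (ex_intro _ x (or_introl erefl)).
  by case: zxy zmin => -> zmin; [left|right]; apply: zmin; [right|left].
(* Two points related both ways would both be least in the pair they form, and least elements are
   unique for the given well-order. *)
have anti (x y : T) : R x y -> R y x -> x = y.
  move=> Rxy Ryx; have refl u : R u u by case: (tot u u).
  have /wo[z [_ zmin]] :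
      nonempty (fun u : {classic T} => asbool (u = x \/ u = y)).
    by exists x; apply/asboolP; left.
  by rewrite -(zmin x) ?(zmin y) //;
    split=> [|u]; rewrite unfold_in; [apply/asboolP; tauto| | |];
    try (move/asboolP=> [] -> //); apply/asboolP; tauto.
exists (fun x y => R x y /\ x <> y); split.
- move=> x; apply: NNPP => nacc.
  have [z nz zmin] := least _ (ex_intro (fun x => ~ Acc _ x) x nacc).
  apply: nz; constructor=> y [Ryz ne]; apply: NNPP => /zmin Rzy.
  by apply: ne; apply: anti.
- move=> x y z [Rxy nxy] [Ryz nyz]; split; last first.
    by move=> exz; apply: nxy; apply: anti => //; rewrite exz.
  have [w wxyz wmin] := least (fun w => w = x \/ w = y \/ w = z) (ex_intro _ x (or_introl erefl)).
  case: wxyz wmin => [->|[->|->]] wmin.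
  + by apply: wmin; tauto.
  + by case: nxy; apply: anti => //; apply: wmin; tauto.
  + by case: nyz; apply: anti => //; apply: wmin; tauto.
- move=> x y; case: (classic (x = y)) => [->|nxy]; first by right; left.
  by case: (tot x y) => Rxy; [left|right; right]; split=> // eyx; apply: nxy.
Qed.

Lemma swo_irr (T : Type) (lt : T -> T -> Prop) x : strict_well_order lt -> ~ lt x x.
Proof. by move=> H; elim: (swo_wf H x) => y _ IH yy; apply: (IH y). Qed.

Lemma swo_least (T : Type) (lt : T -> T -> Prop) (P : T -> Prop) :
  strict_well_order lt -> (exists x, P x) ->
  exists z, P z /\ forall x, P x -> ~ lt x z.
Proof.
move=> H [x]; elim: (swo_wf H x) => y _ IH Py.
case: (classic (exists z, P z /\ lt z y)) => [[z [Pz zy]]|nz]; first exact: (IH z).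
by exists y; split=> // z Pz zy; apply: nz; exists z.
Qed.

Lemma swo_sub (T : Type) (lt : T -> T -> Prop) (P : T -> Prop) :
  strict_well_order lt ->
  strict_well_order (fun x y : {t | P t} => lt (proj1_sig x) (proj1_sig y)).
Proof.
move=> H; split.
- exact: wf_inverse_image (swo_wf H).
- by move=> x y z; apply: (swo_trans H).
- move=> [x px] [y py] /=; case: (swo_total H x y) => [|[E|]]; [tauto| |tauto].
  by right; left; apply: subset_eq_compat.
Qed.

(** The step of the recursion is only known to exist relative to the earlier values. It is chosen
    uniformly for all possible histories first, and then iterated. *)
Lemma wf_dependent_choice (Z Y : Type) (R : Z -> Z -> Prop)
    (P : forall z, (forall y, R y z -> Y) -> Y -> Prop) :
  well_founded R -> (forall z prev, exists v, P z prev v) ->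
  exists g : Z -> Y, forall z, P z (fun y _ => g y) (g z).
Proof.
move=> wfR ex.
pose step z prev := proj1_sig (constructive_indefinite_description _ (ex z prev)).
exists (Fix wfR (fun _ => Y) step) => z.
rewrite Fix_eq; last first.
  move=> x f g fg; congr step; apply: functional_extensionality_dep => y.
  by apply: functional_extensionality_dep.
exact: (proj2_sig (constructive_indefinite_description _ (ex z _))).
Qed.

(** * Cardinal arithmetic *)

Lemma card_le_refl (A : Type) : card_le A A.
Proof. by exists id. Qed.

Lemma card_le_trans (A B C : Type) : card_le A B -> card_le B C -> card_le A C.
Proof. by move=> [f fi] [g gi]; exists (fun x => g (f x)) => x y /gi /fi. Qed.

Lemma card_le_rel (A B : Type) (R : A -> B -> Prop) :
  (forall a, exists b, R a b) -> (forall a a' b, R a b -> R a' b -> a = a') ->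
  card_le A B.
Proof.
move=> ex inj.
have [f fR] : exists f, forall a, R a (f a).
  exists (fun a => proj1_sig (constructive_indefinite_description _ (ex a))) => a.
  exact: proj2_sig.
by exists f => x y E; apply: (inj x y (f x)); [|rewrite E].
Qed.

Lemma card_le_setP (A B : Type) (P : A -> Prop) :
  card_le {a | P a} B <->
  exists R : A -> B -> Prop, (forall a, P a -> exists b, R a b) /\
    forall a a' b, P a -> P a' -> R a b -> R a' b -> a = a'.
Proof.
split.
  move=> [f fi]; exists (fun a b => exists p : P a, f (exist _ a p) = b); split.
    by move=> a p; exists (f (exist _ a p)), p.
  by move=> a a' b _ _ [p <-] [q /fi []].
move=> [R [ex inj]]; apply: (@card_le_rel _ _ (fun a b => R (proj1_sig a) b)).
  by move=> [a p]; apply: ex.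
move=> [a p] [a' p'] b /= r r'; apply: subset_eq_compat; exact: (inj a a' b).
Qed.

Lemma card_le_subset (A : Type) (P Q : A -> Prop) :
  (forall a, P a -> Q a) -> card_le {a | P a} {a | Q a}.
Proof.
move=> PQ; exists (fun a => exist Q (proj1_sig a) (PQ _ (proj2_sig a))).
by move=> [a p] [b q] [E]; apply: subset_eq_compat.
Qed.

Lemma card_le_sig (A : Type) (P : A -> Prop) : card_le {a | P a} A.
Proof. exists (@proj1_sig _ _) => [[a p]] [b q] /= E; exact: subset_eq_compat. Qed.

Lemma card_le_prod (A B C D : Type) :
  card_le A B -> card_le C D -> card_le (A * C) (B * D).
Proof.
move=> [f fi] [g gi]; exists (fun p => (f (fst p), g (snd p))).
by move=> [a c] [b d] [/fi -> /gi ->].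
Qed.

(** If no colour were free at [z], sending each colour to a predecessor carrying it would inject [T]
    into the predecessors of [z]. *)
Lemma greedy_coloring (Z T : Type) (R : Z -> Z -> Prop) :
  well_founded R -> (forall z, ~ card_le T {y | R y z}) ->
  exists g : Z -> T, forall y z, R y z -> g y <> g z.
Proof.
move=> wfR small.
pose P z (prev : forall y, R y z -> T) t := forall y (r : R y z), prev y r <> t.
have [|g gP] := @wf_dependent_choice Z T R P wfR.
  move=> z prev; apply: NNPP => none; apply: (small z).
  apply: (@card_le_rel _ _ (fun t y => prev (proj1_sig y) (proj2_sig y) = t)).
    move=> t; apply: NNPP => nt; apply: none; exists t => y r E; apply: nt.
    by exists (exist _ y r).
  by move=> a a' b <- <-.
by exists g => y z; apply: gP.
Qed.

Lemma greedy_injection (Z T : Type) (lt : Z -> Z -> Prop) :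
  strict_well_order lt -> (forall z, ~ card_le T {y | lt y z}) -> card_le Z T.
Proof.
move=> H small; have [g gP] := greedy_coloring (swo_wf H) small.
exists g => x y E; case: (swo_total H x y) => [|[//|]] /gP; first by rewrite E.
by rewrite E.
Qed.

Lemma card_le_total (A B : Type) : card_le A B \/ card_le B A.
Proof.
have [lt H] := well_ordering A.
case: (classic (exists z, card_le B {y | lt y z})) => [[z le]|none].
  by right; apply: card_le_trans le (card_le_sig _).
by left; apply: (greedy_injection H) => z le; apply: none; exists z.
Qed.

Lemma card_le_nat_sq : card_le (nat * nat) nat.
Proof.
exists to_nat => x y E; by rewrite -(cancel_of_to x) -(cancel_of_to y) E.
Qed.

Lemma card_le_add_point (A B : Type) (P : A -> Prop) (a0 : A) :
  card_le nat B -> card_le {a | P a} B -> card_le {a | P a \/ a = a0} B.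
Proof.
move=> [i ii] /(card_le_setP _) [R [ex inj]].
(* shift the embedded copy of [nat] by one *)
pose sh b c := (exists n, b = i n /\ c = i (S n)) \/ ((forall n, b <> i n) /\ c = b).
have shex b : exists c, sh b c.
  case: (classic (exists n, b = i n)) => [[n E]|none].
    by exists (i (S n)); left; exists n.
  by exists b; right; split=> // n E; apply: none; exists n.
have shinj b b' c : sh b c -> sh b' c -> b = b'.
  by move=> [[n [-> ->]]|[nb ->]] [[m [-> E]]|[nb' E]] //;
    [move/ii: E => [->]|case: (nb' (S n))|case: (nb (S m))].
have sh0 b : ~ sh b (i 0).
  by move=> [[n [_ /ii]]|[nb E]] //; apply: (nb 0).
apply/card_le_setP.
exists (fun a c => (a = a0 /\ c = i 0) \/ (a <> a0 /\ exists b, R a b /\ sh b c)); split.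
  move=> a Pa; case: (classic (a = a0)) => [->|ne]; first by exists (i 0); left.
  case: Pa => // /ex [b Rb]; have [c bc] := shex b.
  by exists c; right; split=> //; exists b.
move=> a a' c Pa Pa' [[-> ->]|[ne [b [Rb bc]]]] [[-> E]|[ne' [b' [Rb' bc']]]] //.
- by case: (sh0 b').
- by rewrite E in bc; case: (sh0 b).
- have E := shinj _ _ _ bc bc'; subst b'.
  by apply: (inj a a' b); tauto.
Qed.

(* Goedel's pairing order: pairs are compared by their maximum first, so that
   initial segments of [Z * Z] are covered by squares of initial segments. *)
Lemma card_le_sq_of_segments (Z : Type) (lt : Z -> Z -> Prop) :
  strict_well_order lt -> card_le nat Z ->
  (forall z, card_le nat {y | lt y z} ->
     card_le ({y | lt y z} * {y | lt y z}) {y | lt y z}) ->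
  card_le (Z * Z) Z.
Proof.
move=> H infZ IH.
case: (classic (exists z, card_le Z {y | lt y z})) => [[z le]|big].
  apply: card_le_trans (card_le_prod le le) _.
  by apply: card_le_trans (card_le_sig (fun y => lt y z)); apply: IH; apply: card_le_trans le.
case: (classic (exists z, card_le nat {y | lt y z})) => [[m0 inf0]|fin]; last first.
  have le : card_le Z nat.
    by apply: (greedy_injection H) => z inf; apply: fin; exists z.
  by apply: card_le_trans (card_le_prod le le) _; apply: card_le_trans card_le_nat_sq infZ.
pose le x y := lt x y \/ x = y.
have tot x y : le x y \/ le y x by rewrite /le; case: (swo_total H x y) => [|[]]; tauto.
pose isub (p : Z * Z) m := le (fst p) m /\ le (snd p) m.
have exmx (p : Z * Z) : exists m, isub p m /\ (m = fst p \/ m = snd p).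
  case: (tot (fst p) (snd p)) => h; [exists (snd p)|exists (fst p)];
    by rewrite /isub /le; tauto.
pose mx p := proj1_sig (constructive_indefinite_description _ (exmx p)).
have mxP p : isub p (mx p).
  by case: (proj2_sig (constructive_indefinite_description _ (exmx p))).
have [lp Hp] := well_ordering (Z * Z).
pose R p q := lt (mx p) (mx q) \/ (mx p = mx q /\ lp p q).
have HR : strict_well_order R.
  split.
  - have wf z : forall p, mx p = z -> Acc R p.
      elim: (swo_wf H z) => {}z _ IHz p; elim: (swo_wf Hp p) => {}p _ IHp Ep.
      constructor=> q [qp|[Eq qp]]; last by apply: IHp; rewrite ?Eq.
      by apply: (IHz (mx q)); rewrite -?Ep.
    by move=> p; apply: (wf (mx p)).
  - move=> p q r [pq|[E pq]] [qr|[E' qr]].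
    + by left; apply: (swo_trans H) pq qr.
    + by left; rewrite -E'.
    + by left; rewrite E.
    + by right; split; [rewrite E|apply: (swo_trans Hp) pq qr].
  - move=> p q; rewrite /R; case: (swo_total H (mx p) (mx q)) => [|[E|]]; try tauto.
    by case: (swo_total Hp p q) => [|[]]; [left; right|tauto|right; right; right].
have letr x y z : le x y -> le y z -> le x z.
  move=> [xy|->] // [yz|<-]; left=> //; exact: (swo_trans H) xy yz.
apply: (greedy_injection HR) => p small; apply: big.
(* Raising the bound to [m0] at least makes the segment below [m] infinite, as the hypothesis on
   segments requires. *)
have [m [pm m0m]] : exists m, le (mx p) m /\ le m0 m.
  by case: (tot (mx p) m0) => h; [exists m0|exists (mx p)]; rewrite /le; split=> //; right.
have infm : card_le nat {y | lt y m}.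
  apply: card_le_trans inf0 (card_le_subset _) => y ym0.
  by case: m0m => [h|<-] //; apply: (swo_trans H) ym0 h.
exists m; apply: card_le_trans small _.
have leQ : card_le {y | le y m} {y | lt y m}.
  exact: (@card_le_add_point _ _ (fun y => lt y m) m infm (card_le_refl _)).
apply: card_le_trans (IH m infm); apply: card_le_trans (card_le_prod leQ leQ).
have inQ q : R q p -> le (fst q) m /\ le (snd q) m.
  move=> r; have qp : le (mx q) (mx p) by rewrite /le; case: r => [|[]]; tauto.
  by case: (mxP q) => h1 h2; split; apply: (letr _ (mx p)) => //; apply: (letr _ (mx q)).
exists (fun q : {q | R q p} =>
  (exist (fun y => le y m) _ (proj1 (inQ _ (proj2_sig q))),
   exist (fun y => le y m) _ (proj2 (inQ _ (proj2_sig q))))).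
move=> [[a b] r] [[c d] r'] [/= E1 E2]; subst; exact: subset_eq_compat.
Qed.

(** A segment of a segment is again a segment, up to nested subset types, so induction on the
    endpoint supplies the hypothesis of [card_le_sq_of_segments]. *)
Lemma card_le_sq (M : Type) : card_le nat M -> card_le (M * M) M.
Proof.
move=> infM; have [lt H] := well_ordering M.
apply: (card_le_sq_of_segments H infM) => z.
elim: (swo_wf H z) => {}z _ IH infz.
apply: (card_le_sq_of_segments (swo_sub (fun y => lt y z) H) infz) => [[y yz]] /=.
have flat : card_le {w : {t | lt t z} | lt (proj1_sig w) y} {t | lt t y}.
  exists (fun w : {w : {t | lt t z} | lt (proj1_sig w) y} =>
    exist (fun t => lt t y) (proj1_sig (proj1_sig w)) (proj2_sig w)).
  by move=> [[a p] q] [[b p'] q'] [/= E]; subst b; do 2!apply: subset_eq_compat.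
have flat' : card_le {t | lt t y} {w : {t | lt t z} | lt (proj1_sig w) y}.
  exists (fun w => exist (fun w : {t | lt t z} => lt (proj1_sig w) y)
    (exist _ (proj1_sig w) (swo_trans H (proj2_sig w) yz)) (proj2_sig w)).
  by move=> [a p] [b q] [/= E]; apply: subset_eq_compat.
move=> inf; apply: card_le_trans (card_le_prod flat flat) _.
by apply: card_le_trans flat'; apply: IH => //; apply: card_le_trans inf flat.
Qed.

Lemma card_le_bigcup (I A M : Type) (P : I -> Prop) (Q : I -> A -> Prop) :
  card_le nat M -> card_le {i | P i} M -> (forall i, P i -> card_le {a | Q i a} M) ->
  card_le {a | exists i, P i /\ Q i a} M.
Proof.
move=> infM leI leQ; apply: card_le_trans (card_le_sq infM).
have [S [Sex Sinj]] := proj1 (card_le_setP _ _) leI.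
have [T TP] : exists T : I -> A -> M -> Prop, forall i, P i ->
    (forall a, Q i a -> exists b, T i a b) /\
    forall a a' b, Q i a -> Q i a' -> T i a b -> T i a' b -> a = a'.
  apply: (choice (fun i T => P i -> (forall a, Q i a -> exists b : M, T a b) /\
    forall a a' b, Q i a -> Q i a' -> T a b -> T a' b -> a = a')) => i.
  case: (classic (P i)) => [p|np]; last by exists (fun _ _ => True).
  by have [T TP] := proj1 (card_le_setP _ _) (leQ i p); exists T.
apply/card_le_setP.
exists (fun a mm => exists i, P i /\ Q i a /\ S i (fst mm) /\ T i a (snd mm)); split.
  move=> a [i [p q]]; have [m1 s] := Sex i p; have [m2 t] := proj1 (TP i p) a q.
  by exists (m1, m2), i.
move=> a a' [m1 m2] _ _ [i [p [q [/= s t]]]] [i' [p' [q' [/= s' t']]]].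
have E := Sinj _ _ _ p p' s s'; subst i'.
exact: (proj2 (TP i p) a a' m2).
Qed.

Lemma card_le_setU (A M : Type) (P Q : A -> Prop) :
  card_le nat M -> card_le {a | P a} M -> card_le {a | Q a} M ->
  card_le {a | P a \/ Q a} M.
Proof.
move=> infM leP leQ.
have leb : card_le {b : bool | True} M.
  apply: card_le_trans infM; exists (fun b => if proj1_sig b then 0 else 1).
  by move=> [[] []] [[] []].
apply: card_le_trans
  (@card_le_bigcup bool A M (fun _ => True) (fun b a => if b then P a else Q a) infM leb _).
  by apply: card_le_subset => a [p|q]; [exists true|exists false].
by case.
Qed.

Lemma card_le_list (M : Type) : card_le nat M -> card_le (list M) M.
Proof.
move=> infM; have [z _] := infM.
have lev n : card_le {l : list M | length l = n} M.
  elim: n => [|n [f fi]].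
    by exists (fun _ => z 0) => [[[|x l] p]] [[|y l'] q] //= _; apply: subset_eq_compat.
  apply: card_le_trans (card_le_sq infM); apply/card_le_setP.
  exists (fun l p => exists (t : {l | length l = n}) x,
    l = x :: proj1_sig t /\ p = (x, f t)); split.
    move=> [|x l] //= [p]; exists (x, f (exist _ l p)), (exist _ l p), x; split=> //.
  by move=> l l' p _ _ [t [x [-> ->]]] [t' [x' [-> [-> /fi ->]]]].
have nn : card_le {n : nat | True} M := card_le_trans (card_le_sig _) infM.
apply: card_le_trans (card_le_bigcup infM nn (fun n _ => lev n)).
exists (fun l => exist _ l (ex_intro _ (length l) (conj I erefl))).
by move=> x y [].
Qed.

(** Cantor-Schroeder-Bernstein: the bijection follows [f] on [C] and the inverse of [g]
    elsewhere. *)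
Lemma card_le_anti (A B : Type) : card_le A B -> card_le B A -> card_eq A B.
Proof.
move=> [f fi] [g gi].
(* [C] is the set of points of [A] whose backward orbit stops in [A] *)
pose C a := exists n a0, (forall b, g b <> a0) /\ a = Nat.iter n (fun x => g (f x)) a0.
pose R a b := (C a /\ b = f a) \/ (~ C a /\ a = g b).
have exb a : exists b, R a b.
  case: (classic (C a)) => c; first by exists (f a); left.
  apply: NNPP => none; apply: (c); exists 0, a; split=> // b E.
  by apply: none; exists b; right.
have CS a : C a -> C (g (f a)) by move=> [n [a0 [h ->]]]; exists (S n), a0.
have exa b : exists a, R a b.
  case: (classic (C (g b))) => c; last by exists (g b); right.
  have [[|n] [a0 [h E]]] := c; first by case: (h b).
  exists (Nat.iter n (fun x => g (f x)) a0); left; split; last by apply: gi.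
  by exists n, a0.
have injR a a' b : R a b -> R a' b -> a = a'.
  move=> [[c E]|[c E]] [[c' E']|[c' E']].
  - by apply: fi; rewrite -E.
  - by case: c'; rewrite E' E; apply: CS.
  - by case: c; rewrite E E'; apply: CS.
  - by rewrite E.
have funR a b b' : R a b -> R a b' -> b = b'.
  by move=> [[c E]|[c E]] [[c' E']|[c' E']] //; [rewrite E|apply: gi; rewrite -E].
have [u uR] := choice _ exb; have [v vR] := choice _ exa.
exists u, v; split=> [x|y]; [exact: injR (vR _) (uR _)|exact: funR (uR _) (vR _)].
Qed.

(** * Successor cardinals as well-orders *)

(** The clauses force the order type to be the initial ordinal of $|M|^+$, so that suprema and clubs
    can be treated without a theory of ordinals. *)
Record successor_order (M W : Type) (lt : W -> W -> Prop) : Prop := {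
  so_wo : strict_well_order lt;
  so_inf : card_le nat M;
  so_seg : forall w, card_le {x | lt x w} M;
  so_big : ~ card_le W M }.

(** The points whose segment has size at most $|M|$ form an initial part of [Z]. If this part had
    size at most $|M|$, the least point outside it would have a segment that small as well, and so
    would belong to it. *)
Lemma successor_order_exists (M Z : Type) :
  card_le nat M -> ~ card_le Z M ->
  exists (P : Z -> Prop) (lt : {z | P z} -> {z | P z} -> Prop),
    successor_order M lt.
Proof.
move=> infM big; have [lt H] := well_ordering Z.
exists (fun z => card_le {y | lt y z} M).
exists (fun x y => lt (proj1_sig x) (proj1_sig y)); split.
- exact: swo_sub.
- exact: infM.
- move=> [w pw] /=; apply: card_le_trans pw.
  exists (fun x : {x : {z | card_le {y | lt y z} M} | lt (proj1_sig x) w} =>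
    exist (fun y => lt y w) (proj1_sig (proj1_sig x)) (proj2_sig x)).
  by move=> [[a p] q] [[b p'] q'] [/= E]; subst b; do 2!apply: subset_eq_compat.
- move=> le.
  case: (classic (exists z, ~ card_le {y | lt y z} M)) => [ex|none]; last first.
    apply: big; apply: card_le_trans le.
    have all z : card_le {y | lt y z} M by apply: NNPP => nz; apply: none; exists z.
    by exists (fun z => exist _ z (all z)) => x y [].
  have [z [nz zmin]] := swo_least H ex.
  apply: nz; apply: card_le_trans le; apply: card_le_subset => y yz.
  by apply: NNPP => /zmin.
Qed.

Lemma successor_order_pullback (M W K : Type) (lt : W -> W -> Prop) :
  successor_order M lt -> ~ card_le K M -> card_le K W ->
  exists lt' : K -> K -> Prop, successor_order M lt'.
Proof.
move=> so big [f fi]; exists (fun x y => lt (f x) (f y)); split; last exact: big.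
- have H := so_wo so; split; first exact: wf_inverse_image (swo_wf H).
    by move=> x y z; apply: (swo_trans H).
  move=> x y; case: (swo_total H (f x) (f y)) => [|[/fi|]]; tauto.
- exact: so_inf so.
- move=> w; apply: card_le_trans (so_seg so (f w)).
  exists (fun x : {x | lt (f x) (f w)} => exist (fun y => lt y (f w)) _ (proj2_sig x)).
  by move=> [a p] [b q] [/= /fi E]; apply: subset_eq_compat.
Qed.

Lemma successor_order_le (M W : Type) (lt : W -> W -> Prop) :
  successor_order M lt -> card_le M W.
Proof. by move=> so; case: (card_le_total M W) => // /(so_big so). Qed.

(** This is regularity of successor cardinals: an unbounded [g] would cover [W] by at most $|M|$
    closed segments, each of size at most $|M|$. *)
Lemma successor_order_bounded (M W I : Type) (lt : W -> W -> Prop) (g : I -> W) :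
  successor_order M lt -> card_le I M -> exists w, forall i, lt (g i) w.
Proof.
move=> so leI; apply: NNPP => unb; apply: (so_big so).
have le w : card_le {x | lt x w \/ x = w} M.
  exact: (card_le_add_point w (so_inf so) (so_seg so w)).
have leI' : card_le {i : I | True} M := card_le_trans (card_le_sig _) leI.
apply: card_le_trans (card_le_bigcup (so_inf so) leI' (fun i _ => le (g i))).
suff all w : exists i, True /\ (lt w (g i) \/ w = g i).
  by exists (fun w => exist _ w (all w)) => x y [].
apply: NNPP => none; apply: unb; exists w => i.
case: (swo_total (so_wo so) (g i) w) => [//|[E|l]]; case: none; exists i; split=> //; last by left.
by right.
Qed.

Lemma successor_order_bounded2 (M W : Type) (lt : W -> W -> Prop) a b :
  successor_order M lt -> exists c, lt a c /\ lt b c.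
Proof.
move=> so; have le : card_le bool M.
  apply: card_le_trans (so_inf so); exists (fun b : bool => if b then 0 else 1).
  by move=> [] [].
have [c h] := successor_order_bounded (fun x : bool => if x then a else b) so le.
by exists c; split; [apply: (h true)|apply: (h false)].
Qed.

(** * Closure points and club guessing *)

(* A club subset of a successor cardinal contains the closure points of some
   function [k], so functions stand for clubs throughout. *)
Definition closure_point (W : Type) (lt : W -> W -> Prop) (k : W -> W) (i : W) : Prop :=
  forall j, lt j i -> lt (k j) i.

Lemma closure_point_weaken (W : Type) (lt : W -> W -> Prop) (k k' : W -> W) i :
  strict_well_order lt -> (forall x, lt (k x) (k' x)) ->
  closure_point lt k' i -> closure_point lt k i.
Proof. by move=> H kk' c j ji; apply: (swo_trans H) (kk' j) (c j ji). Qed.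

(** The floor is the supremum of the closure points up to [x]. Any [j] below it lies below one of
    these closure points, which then bounds [k j]. *)
Lemma closure_point_floor (W : Type) (lt : W -> W -> Prop) (k : W -> W) x :
  strict_well_order lt ->
  exists i, closure_point lt k i /\ ~ lt x i /\
    forall i', closure_point lt k i' -> ~ lt x i' -> ~ lt i i'.
Proof.
move=> H.
have [|y [ub ymin]] := @swo_least _ _
  (fun y => forall i, closure_point lt k i -> ~ lt x i -> ~ lt y i) H.
  by exists x.
exists y; split; last by split=> //; apply: ymin.
move=> j jy; apply: NNPP => nk; apply: (ymin j) (jy) => i ci xi ji.
apply: nk; case: (swo_total H i y) => [iy|[E|/(ub i ci xi)//]].
  exact: (swo_trans H) (ci j ji) iy.
by rewrite -E; apply: ci.
Qed.

Lemma least_strict_upper_bound (M W I : Type) (lt : W -> W -> Prop) (g : I -> W) :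
  successor_order M lt -> card_le I M ->
  exists y, (forall i, lt (g i) y) /\ forall x, lt x y -> exists i, ~ lt (g i) x.
Proof.
move=> so le; have [y [ub ymin]] := swo_least (so_wo so) (successor_order_bounded g so le).
exists y; split=> // x xy; apply: not_all_ex_not => all; exact: (ymin x).
Qed.

Lemma nlt_lt_trans (W : Type) (lt : W -> W -> Prop) x y z :
  strict_well_order lt -> ~ lt y x -> lt y z -> lt x z.
Proof.
move=> H nyx yz; case: (swo_total H x y) => [xy|[->|]] //; exact: (swo_trans H) xy yz.
Qed.

Lemma lt_nlt_trans (W : Type) (lt : W -> W -> Prop) x y z :
  strict_well_order lt -> lt x y -> ~ lt z y -> lt x z.
Proof.
move=> H xy nzy; case: (swo_total H y z) => [yz|[<-|]] //; exact: (swo_trans H) xy yz.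
Qed.

(** The supremum of the countably many iterates of [nx] at [x] is a closure point. *)
Lemma closure_point_unbounded (M W : Type) (lt : W -> W -> Prop) (k : W -> W) x :
  successor_order M lt -> exists i, lt x i /\ closure_point lt k i.
Proof.
move=> so; have H := so_wo so.
have [nx nxP] : exists nx : W -> W, forall y, lt y (nx y) /\ forall j, lt j y -> lt (k j) (nx y).
  apply: (choice (fun y y' => lt y y' /\ forall j, lt j y -> lt (k j) y')) => y.
  have [w wP] :=
    successor_order_bounded (fun j : {j | lt j y} => k (proj1_sig j)) so (so_seg so y).
  have [c [yc wc]] := successor_order_bounded2 y w so.
  by exists c; split=> // j jy; apply: (swo_trans H) wc; apply: (wP (exist _ j jy)).
have [i [ub least]] :=
  least_strict_upper_bound (fun n => Nat.iter n nx x) so (so_inf so).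
exists i; split; first exact: (ub 0).
move=> j ji; have [n nj] := least j ji.
have jn : lt j (Nat.iter (S n) nx x) by apply: nlt_lt_trans nj _ => //=; apply: (proj1 (nxP _)).
exact: (swo_trans H) (proj2 (nxP _) j jn) (ub (S (S n))).
Qed.

(* Shelah's club guessing with a gap of two cardinals. *)
Lemma club_guessing (W1 W2 W3 : Type) (l1 : W1 -> W1 -> Prop)
    (l2 : W2 -> W2 -> Prop) (l3 : W3 -> W3 -> Prop) :
  successor_order nat l1 -> successor_order W1 l2 -> successor_order W2 l3 ->
  exists C : W3 -> W3 -> Prop, forall k : W3 -> W3, exists d,
    ~ card_le {x | C d x} nat /\ forall x, C d x -> closure_point l3 k x.
Proof.
move=> s1 s2 s3; have H1 := so_wo s1; have H2 := so_wo s2; have H3 := so_wo s3.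
pose ladder d (c : W1 -> W3) :=
  (forall j, l3 (c j) d) /\ forall x, l3 x d -> exists j, ~ l3 (c j) x.
have [c cP] : exists c : W3 -> W1 -> W3, forall d, (exists c', ladder d c') -> ladder d (c d).
  apply: (choice (fun d c => (exists c', ladder d c') -> ladder d c)) => d.
  by case: (classic (exists c', ladder d c')) => [[c' h]|h]; [exists c'|exists (fun _ => d)].
have [fl flP] := choice _ (fun kx : (W3 -> W3) * W3 =>
  closure_point_floor (fst kx) (snd kx) H3).
(* A candidate guess at [d] is the ladder [c d] pushed down to closure points of [k]. If no [k]
   yields a guessing family, every [k] has a counterexample [nx k], and these are iterated along
   [W2]. *)
pose C k d x := exists j, x = fl (k, c d j).
apply: NNPP => fails.
have [nx nxP] : exists nx : (W3 -> W3) -> W3 -> W3, forall k d,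
    ~ card_le {x | C k d x} nat -> ~ forall x, C k d x -> closure_point l3 (nx k) x.
  apply: (choice (fun k k' => forall d, ~ card_le {x | C k d x} nat ->
    ~ forall x, C k d x -> closure_point l3 k' x)) => k.
  apply: NNPP => none; apply: fails; exists (C k) => k'; apply: NNPP => none'.
  by apply: none; exists k' => d unc all; apply: none'; exists d.
have [kk kkP] : exists kk : W2 -> W3 -> W3, forall i j, l2 j i -> forall x,
    l3 (kk j x) (kk i x) /\ l3 (nx (kk j) x) (kk i x).
  have [|kk kkP] := @wf_dependent_choice W2 (W3 -> W3) l2
    (fun i prev v => forall j (r : l2 j i) x,
       l3 (prev j r x) (v x) /\ l3 (nx (prev j r) x) (v x)) (swo_wf H2); last first.
    by exists kk => i j r; apply: kkP.
  move=> i prev.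
  suff [v vP] : exists v : W3 -> W3, forall x, forall j (r : l2 j i),
      l3 (prev j r x) (v x) /\ l3 (nx (prev j r) x) (v x) by exists v => j r x; apply: vP.
  apply: (choice (fun x v => forall j (r : l2 j i),
    l3 (prev j r x) v /\ l3 (nx (prev j r) x) v)) => x.
  have le : card_le {j | l2 j i} W2 := card_le_sig _.
  have [a aP] := successor_order_bounded (fun j => prev _ (proj2_sig j) x) s3 le.
  have [b bP] := successor_order_bounded (fun j => nx (prev _ (proj2_sig j)) x) s3 le.
  have [v [av bv]] := successor_order_bounded2 a b s3.
  exists v => j r; split; first exact: (swo_trans H3) (aP (exist _ j r)) av.
  exact: (swo_trans H3) (bP (exist _ j r)) bv.
(* Closure points of [kinf] are closure points of every [kk i]. The failure is tested at the
   supremum [d] of an increasing [W1]-sequence [z] of such points. *)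
have [kinf kinfP] := choice _ (fun x =>
  successor_order_bounded (fun i => kk i x) s3 (card_le_refl _)).
have kinf_kk i x : closure_point l3 kinf x -> closure_point l3 (kk i) x.
  by apply: closure_point_weaken => // y; apply: kinfP.
have [z zP] : exists z : W1 -> W3, forall j, closure_point l3 kinf (z j) /\
    forall j', l1 j' j -> l3 (z j') (z j).
  apply: (@wf_dependent_choice W1 W3 l1 (fun j prev v => closure_point l3 kinf v /\
    forall j' (r : l1 j' j), l3 (prev j' r) v) (swo_wf H1)) => j prev.
  have le : card_le {j' | l1 j' j} W2.
    exact: card_le_trans (card_le_sig _) (successor_order_le s2).
  have [a aP] := successor_order_bounded (fun j' => prev _ (proj2_sig j')) s3 le.
  have [v [av cv]] := closure_point_unbounded kinf a s3.
  exists v; split=> // j' r; exact: (swo_trans H3) (aP (exist _ j' r)) av.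
have [d dP] := least_strict_upper_bound z s3 (successor_order_le s2).
have [cd_lt cd_cof] : ladder d (c d) by apply: cP; exists z.
(* the floors of a fixed ordinal decrease with [i], hence stabilise *)
have [st stP] : exists st : W1 -> W2, forall j i, l2 (st j) i ->
    fl (kk i, c d j) = fl (kk (st j), c d j).
  apply: (choice (fun j s => forall i, l2 s i ->
    fl (kk i, c d j) = fl (kk s, c d j))) => j.
  have [|v [[s ->] vmin]] := @swo_least _ _ (fun v => exists i, v = fl (kk i, c d j)) H3.
    have [i _] := successor_order_bounded (fun x : {x : W1 | False} => 
      match proj2_sig x with end) s2 (card_le_sig _).
    by exists (fl (kk i, c d j)), i.
  exists s => i si.
  have [ci [xi imax]] := flP (kk i, c d j); have [cs [xs smax]] := flP (kk s, c d j).
  case: (swo_total H3 (fl (kk i, c d j)) (fl (kk s, c d j))) => [lt|[//|lt]].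
    by case: (vmin (fl (kk i, c d j))) => //; exists i.
  case: (smax (fl (kk i, c d j))) => //.
  apply: closure_point_weaken ci => // y; exact: (proj1 (kkP _ _ si y)).
(* By regularity some [i] lies past all stages [st j]. The floors for [kk i] then agree with those
   for a later [kk i'], hence are closure points of [nx (kk i)]. *)
have [i iP] := successor_order_bounded st s2 (card_le_refl _).
have [i' [ii' _]] := successor_order_bounded2 i i s2.
apply: (nxP (kk i) d); last first.
  move=> x [j ->].
  have -> : fl (kk i, c d j) = fl (kk i', c d j).
    by rewrite !(stP j) //; apply: (swo_trans H2) (iP j) ii'.
  have [ci _] := flP (kk i', c d j).
  apply: closure_point_weaken ci => // y; exact: (proj2 (kkP _ _ ii' y)).
(* A countable candidate would be bounded by some [z j]. But a ladder point not below [z j] has its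
   floor not below [z j], because [z j] is a closure point of [kk i]. *)
move=> cnt.
have [b bP] : exists b : {x | C (kk i) d x} -> W1, forall x, ~ l3 (z (b x)) (proj1_sig x).
  apply: (choice (fun (x : {x | C (kk i) d x}) j => ~ l3 (z j) (proj1_sig x))) => [[x [j E]]] /=.
  apply: (proj2 dP); have [_ [nl _]] := flP (kk i, c d j); rewrite E.
  exact: (nlt_lt_trans H3 nl (cd_lt j)).
have [j jP] := successor_order_bounded b s1 cnt.
have [j' nj'] := cd_cof (z j) (proj1 dP j).
have [_ [_ imax]] := flP (kk i, c d j').
apply: (imax (z j)) => //; first by apply: kinf_kk; apply: (proj1 (zP j)).
have := bP (exist _ _ (ex_intro _ j' erefl)) => /= nb.
by apply: nlt_lt_trans nb _ => //; apply: (proj2 (zP j)).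
Qed.

(** * Cardinals below a singular cardinal of countable cofinality *)

Lemma successor_order_gap (M W T : Type) (lt : W -> W -> Prop) :
  successor_order M lt -> card_le W T \/ card_le T M.
Proof.
move=> so; case: (classic (exists w, card_le T {x | lt x w})) => [[w le]|none].
  by right; apply: card_le_trans le (so_seg so w).
by left; apply: (greedy_injection (so_wo so)) => w le; apply: none; exists w.
Qed.

(** If $|L| \le |M|^+$, each of the countably many smaller pieces of [L] would have size at most
    $|M|$, and then so would [L]. *)
Lemma singular_limit (L M W : Type) (lt : W -> W -> Prop) :
  singular_countable_cof L -> successor_order M lt -> ~ card_le L M -> ~ card_le L W.
Proof.
move=> [_ [A [cov small]]] so LM LW; apply: LM.
have le n : card_le {x | A n x} M.
  case: (successor_order_gap {x | A n x} so) => // WA.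
  by case: (proj2 (small n)); apply: card_le_trans LW WA.
have nn : card_le {n : nat | True} M := card_le_trans (card_le_sig _) (so_inf so).
apply: card_le_trans (card_le_bigcup (so_inf so) nn (fun n _ => le n)).
have all x : exists n, True /\ A n x by have [n h] := cov x; exists n.
by exists (fun x => exist _ x (all x)) => x y [].
Qed.

Lemma singular_successor (L M : Type) :
  singular_countable_cof L -> card_le nat M -> ~ card_le L M ->
  exists (W : Type) (lt : W -> W -> Prop),
    successor_order M lt /\ card_le W L /\ ~ card_le L W.
Proof.
move=> sing infM LM; have [P [lt so]] := successor_order_exists infM LM.
exists {z | P z}, lt; split=> //; split; first exact: card_le_sig.
exact: singular_limit so LM.
Qed.

(** By comparability of cardinals, [N] can be taken to be [W] or one of the pieces, whichever is
    largest; including [W] keeps it infinite. *)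
Lemma singular_initial_union (L W : Type) (A : nat -> L -> Prop) n :
  (forall n, card_lt {x : L | A n x} L) -> card_le nat W -> ~ card_le L W ->
  exists N : Type, card_le W N /\ card_le {x | exists k, k <= n /\ A k x} N /\ ~ card_le L N.
Proof.
move=> small infW LW; elim: n => [|n [N [WN [SN LN]]]].
  have one : card_le {x | exists k, k <= 0 /\ A k x} {x | A 0 x}.
    apply: card_le_subset => x [k [k0 h]]; have E : k = 0 by lia.
    by rewrite -E.
  case: (card_le_total W {x | A 0 x}) => le.
    exists {x | A 0 x}; split; [exact: le|split; [exact: one|exact: (proj2 (small 0))]].
  by exists W; split; [exact: card_le_refl|split=> //; exact: card_le_trans one le].
have step N' : card_le N N' -> card_le {x | A (S n) x} N' ->
    card_le {x | exists k, k <= S n /\ A k x} N'.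
  move=> NN' AN'.
  have infN' : card_le nat N' by apply: card_le_trans infW _; exact: card_le_trans WN NN'.
  apply: card_le_trans (card_le_setU infN' (card_le_trans SN NN') AN').
  apply: card_le_subset => x [k [kn h]].
  case: (PeanoNat.Nat.eq_dec k (S n)) => [<-|ne]; first by right.
  by left; exists k; split=> //; lia.
case: (card_le_total N {x | A (S n) x}) => le.
  exists {x | A (S n) x}; split; first exact: card_le_trans WN le.
  by split; [apply: step => //; exact: card_le_refl|exact: (proj2 (small _))].
by exists N; split=> //; split=> //; apply: step => //; exact: card_le_refl.
Qed.

(** By induction along [R]: the ancestors of a point are its direct predecessors together with the
    ancestors of these. *)
Lemma clos_trans_card_le (K N : Type) (R : K -> K -> Prop) :
  well_founded R -> card_le nat N -> (forall a, card_le {b | R b a} N) ->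
  forall a, card_le {b | clos_trans K R b a} N.
Proof.
move=> wfR infN le a; elim: (wfR a) => {}a _ IH.
apply: card_le_trans (card_le_setU infN (le a) (card_le_bigcup infN (le a) IH)).
apply: card_le_subset => b /clos_trans_tn1_iff; case=> [|c d cd /clos_trans_tn1_iff bc].
  by left.
by right; exists c.
Qed.

(** * Strict suprema and uncountable chains *)

Definition lsub (I K : Type) (lt : K -> K -> Prop) (P : I -> Prop) (g : I -> K) (y : K) : Prop :=
  (forall i, P i -> lt (g i) y) /\ forall x, lt x y -> exists i, P i /\ ~ lt (g i) x.

Lemma lsub_exists (M W I : Type) (lt : W -> W -> Prop) (P : I -> Prop) (g : I -> W) :
  successor_order M lt -> card_le {i | P i} M -> exists y, lsub lt P g y.
Proof.
move=> so le.
have [y [ub least]] := least_strict_upper_bound (fun i : {i | P i} => g (proj1_sig i)) so le.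
exists y; split=> [i p|x /least [[i p] h]]; first exact: (ub (exist _ i p)).
by exists i.
Qed.

Lemma lsub_unique (I K : Type) (lt : K -> K -> Prop) (P : I -> Prop) (g : I -> K) y y' :
  strict_well_order lt -> lsub lt P g y -> lsub lt P g y' -> y = y'.
Proof.
move=> H [ub least] [ub' least'].
case: (swo_total H y y') => [/least' [i [p]]|[//|/least [i [p]]]] h.
  by case: h; apply: ub.
by case: h; apply: ub'.
Qed.

(* Cofinally many values of [xi] and [xi'] interleave below the closure points
   of [k], so both sequences have the same limits there. *)
Lemma lsub_interleave (W K : Type) (l : W -> W -> Prop) (lt : K -> K -> Prop)
    (xi xi' : W -> K) (k : W -> W) i y :
  strict_well_order lt ->
  (forall j, exists j', ~ lt (xi' j') (xi j) /\ l j' (k j)) ->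
  (forall j, exists j', ~ lt (xi j') (xi' j) /\ l j' (k j)) ->
  (forall x y z, l x y -> l y z -> l x z) ->
  closure_point l k i ->
  lsub lt (fun j => l j i) xi y -> lsub lt (fun j => l j i) xi' y.
Proof.
move=> H k1 k2 ltr ci [ub least]; split.
  move=> j ji; have [j' [n jk]] := k2 j.
  apply: (nlt_lt_trans H n); apply: ub; exact: ltr jk (ci j ji).
move=> x /least [j [ji n]]; have [j' [n' jk]] := k1 j.
exists j'; split; first exact: ltr jk (ci j ji).
by move=> h; apply: n; apply: (nlt_lt_trans H n' h).
Qed.

(* [A n] approximates the order of [K] from below, with initial segments of
   size less than [L].  Every set [e a] of limits of a chosen cofinal
   [omega_3]-sequence in [a] lies below [a] in all [A n]; club guessing then
   yields the uncountable chains. *)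
Lemma uncountable_chains (L K : Type) (lt : K -> K -> Prop) :
  singular_countable_cof L -> successor_order L lt ->
  exists A : nat -> K -> K -> Prop,
    (forall n b a, A n b a -> lt b a) /\
    (forall n a, ~ card_le L {b | A n b a}) /\
    (forall b a, lt b a -> exists n, A n b a) /\
    forall U : K -> Prop, ~ card_le {u | U u} L ->
      exists n (B : K -> Prop), (forall b, B b -> U b) /\ ~ card_le {b | B b} nat /\
        forall b b', B b -> B b' -> lt b b' -> A n b b'.
Proof.
move=> sing so; have H := so_wo so.
have [uncL [D [cov small]]] := sing.
(* [W1], [W2], [W3] represent omega_1, omega_2, omega_3; they stay below $|L|$ because $|L|$ is a
   limit cardinal. *)
have [W1 [l1 [s1 [_ n1]]]] := singular_successor sing (card_le_refl nat) uncL.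
have [W2 [l2 [s2 [_ n2]]]] := singular_successor sing (successor_order_le s1) n1.
have inf2 : card_le nat W2.
  exact: card_le_trans (successor_order_le s1) (successor_order_le s2).
have [W3 [l3 [s3 [le3 n3]]]] := singular_successor sing inf2 n2.
have inf3 : card_le nat W3 by apply: card_le_trans inf2 (successor_order_le s3).
have H3 := so_wo s3.
have [C CP] := club_guessing s1 s2 s3.
have [Rl RlP] := choice _ (fun a => proj1 (card_le_setP _ _) (so_seg so a)).
have [xi' xi'P] : exists xi' : K -> W3 -> K, forall a,
    (exists xi : W3 -> K, lsub lt (fun _ => True) xi a) -> lsub lt (fun _ => True) (xi' a) a.
  apply: (choice (fun a x => (exists xi : W3 -> K, lsub lt (fun _ => True) xi a) ->
    lsub lt (fun _ => True) x a)) => a.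
  case: (classic (exists xi : W3 -> K, lsub lt (fun _ => True) xi a)) => [[x h]|h].
    by exists x.
  by exists (fun _ => a).
(* The set [e a] is indexed by positions in the single sequence [xi' a], so it has at most $|W3|$
   elements. Stage [n] of [Gam] admits the points whose label under [Rl a] lies in the first $n+1$
   pieces of [L], and all of [e a] at every stage. *)
pose e a b := exists i, lsub lt (fun j => l3 j i) (xi' a) b.
pose Gam n b a := lt b a /\ ((exists x, Rl a b x /\ exists k, k <= n /\ D k x) \/ e a b).
have wfG n : well_founded (Gam n).
  by apply: (wf_incl _ _ lt) (swo_wf H) => x y [].
have Glt n b a : clos_trans K (Gam n) b a -> lt b a.
  by elim=> [x y []|x y z _ xy _ yz] //; apply: (swo_trans H) xy yz.
have Gmono n m b a : n <= m -> clos_trans K (Gam n) b a -> clos_trans K (Gam m) b a.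
  move=> nm; elim=> [x y [xy h]|x y z _ xy _ yz]; last exact: t_trans xy yz.
  apply: t_step; split=> //; case: h => [[z [r [k [kn d]]]]|]; [left|by right].
  by exists z; split=> //; exists k; split=> //; lia.
have cover b a : lt b a -> exists n, clos_trans K (Gam n) b a.
  move=> ba; have [x r] := proj1 (RlP a) b ba; have [n h] := cov x.
  exists n; apply: t_step; split=> //; left; exists x; split=> //.
  by exists n; split=> //; lia.
exists (fun n => clos_trans K (Gam n)); split; first exact: Glt.
split.
  move=> n a LG.
  have [N [WN [SN LN]]] := singular_initial_union n small inf3 n3.
  apply: LN; apply: card_le_trans LG _.
  have infN := card_le_trans inf3 WN.
  apply: clos_trans_card_le => // {}a.
  have leA : card_le {b | lt b a /\ exists x, Rl a b x /\ exists k, k <= n /\ D k x} N.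
    have [T [Tex Tinj]] := proj1 (card_le_setP _ _) SN; apply/card_le_setP.
    exists (fun b m => exists x, (Rl a b x /\ exists k, k <= n /\ D k x) /\ T x m); split.
      by move=> b [_ [x [r d]]]; have [m t] := Tex x d; exists m, x.
    move=> b b' m [ba _] [ba' _] [x [[r d] t]] [x' [[r' d'] t']].
    have E := Tinj _ _ _ d d' t t'; subst x'; exact: (proj2 (RlP a)) ba ba' r r'.
  have leE : card_le {b | e a b} N.
    apply: card_le_trans WN; apply/card_le_setP.
    exists (fun b i => lsub lt (fun j => l3 j i) (xi' a) b); split=> // b b' i _ _.
    exact: lsub_unique.
  apply: card_le_trans (card_le_setU infN leA leE).
  by apply: card_le_subset => b [ba [h|h]]; [left|right].
split; first exact: cover.
move=> U bigU.
have unbU x : exists u, U u /\ lt x u.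
  apply: NNPP => none; apply: bigU.
  apply: card_le_trans (card_le_add_point x (so_inf so) (so_seg so x)).
  apply: card_le_subset => u Uu; case: (swo_total H u x) => [|[]]; try tauto.
  by move=> xu; case: none; exists u.
pose below n (X : K -> Prop) b := forall h, X h -> clos_trans K (Gam n) h b.
(* Above some bound of [X], if there is one, lies a member of [U], and [bf] goes beyond it. *)
have [bf bfP] : exists bf : (K -> Prop) * nat -> K, forall Xn,
    (exists b, below (snd Xn) (fst Xn) b) ->
    exists b u, below (snd Xn) (fst Xn) b /\ lt b u /\ U u /\ lt u (bf Xn).
  apply: (choice (fun Xn c => (exists b, below (snd Xn) (fst Xn) b) ->
    exists b u, below (snd Xn) (fst Xn) b /\ lt b u /\ U u /\ lt u c)) => [[X n]] /=.
  case: (classic (exists b, below n X b)) => [[b bX]|none].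
    have [u [Uu bu]] := unbU b; have [c [uc _]] := successor_order_bounded2 u u so.
    by exists c => _; exists b, u.
  have [c _] := successor_order_bounded (fun x : {x : L | False} =>
    match proj2_sig x with end) so (card_le_sig _).
  by exists c => /none.
(* These are the limits of the sequence at indices of [C al] up to and including [g]. Even the limit
   at [g] depends only on values before [g], so the recursion can refer to it. *)
pose upto g (prev : forall j, l3 j g -> K) al h := exists i, C al i /\ ~ l3 g i /\
  (forall j (r : l3 j g), l3 j i -> lt (prev j r) h) /\
  forall x, lt x h -> exists j (r : l3 j g), l3 j i /\ ~ lt (prev j r) x.
(* Which guess will be correct is known only after [xi] is complete. As there are at most $|W3|$
   pairs [(al, n)], each [xi g] can provide for all of them. *)
have [xi xiP] : exists xi : W3 -> K, forall g,
    (forall j, l3 j g -> lt (xi j) (xi g)) /\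
    forall al n, lt (bf (upto g (fun j _ => xi j) al, n)) (xi g).
  apply: (@wf_dependent_choice W3 K l3 (fun g prev v =>
    (forall j (r : l3 j g), lt (prev j r) v) /\
    forall al n, lt (bf (upto g prev al, n)) v) (swo_wf H3)) => g prev.
  have [a aP] := successor_order_bounded (fun j => prev _ (proj2_sig j)) so
    (card_le_trans (card_le_sig (fun j => l3 j g)) le3).
  have le : card_le (W3 * nat) L.
    apply: card_le_trans le3; apply: card_le_trans (card_le_sq inf3).
    exact: card_le_prod (card_le_refl _) inf3.
  have [b bP] := successor_order_bounded (fun p => bf (upto g prev (fst p), snd p)) so le.
  have [v [av bv]] := successor_order_bounded2 a b so.
  exists v; split=> [j r|al n]; first exact: (swo_trans H) (aP (exist _ j r)) av.
  exact: (swo_trans H) (bP (al, n)) bv.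
have uptoP g al h : upto g (fun j _ => xi j) al h <->
    exists i, C al i /\ ~ l3 g i /\ lsub lt (fun j => l3 j i) xi h.
  split=> [[i [ci [gi [ub least]]]]|[i [ci [gi [ub least]]]]]; exists i; do 2!split=> //.
    split=> [j ji|x /least [j [r [ji n]]]]; last by exists j.
    by apply: ub => //; apply: lt_nlt_trans ji gi.
  split=> [j r ji|x /least [j [ji n]]]; first exact: ub.
  have jg : l3 j g by apply: lt_nlt_trans ji gi.
  by exists j, jg.
have all3 : card_le {i : W3 | True} L := card_le_trans (card_le_sig _) le3.
have [d dP] := lsub_exists xi so all3.
have d'P := xi'P d (ex_intro _ xi dP).
(* Both [xi] and the previously fixed [xi' d] have supremum [d], so [k] can be chosen to make them
   interleave below its closure points. *)
have [k kP] : exists k : W3 -> W3, forall j,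
    (exists j', ~ lt (xi' d j') (xi j) /\ l3 j' (k j)) /\
    (exists j', ~ lt (xi j') (xi' d j) /\ l3 j' (k j)).
  apply: (choice (fun j k => (exists j', ~ lt (xi' d j') (xi j) /\ l3 j' k) /\
    (exists j', ~ lt (xi j') (xi' d j) /\ l3 j' k))) => j.
  have [j1 [_ h1]] := proj2 d'P (xi j) (proj1 dP j I).
  have [j2 [_ h2]] := proj2 dP (xi' d j) (proj1 d'P j I).
  have [c [c1 c2]] := successor_order_bounded2 j1 j2 s3.
  by exists c; split; [exists j1|exists j2].
have [al [unc alk]] := CP k.
have [sg sgP] := choice _ (fun i =>
  lsub_exists xi so (card_le_trans (card_le_sig (fun j => l3 j i)) le3)).
have sg_xi i : ~ lt (xi i) (sg i).
  by move=> /(proj2 (sgP i)) [j [ji]] n; apply: n; apply: (proj1 (xiP i)).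
(* At a guessed index the limit of [xi] is also a limit of [xi' d], hence an element of [e d]. *)
have sg_d i : C al i -> clos_trans K (Gam 0) (sg i) d.
  move=> ci; apply: t_step; split.
    exact: (nlt_lt_trans H (sg_xi i) (proj1 dP i I)).
  right; exists i.
  apply: (lsub_interleave H (fun j => proj1 (kP j)) (fun j => proj2 (kP j))
    (swo_trans H3) (alk i ci) (sgP i)).
(* Thus [d] witnesses that each of these sets has a bound, which is the premise of [bfP]; [xi g]
   therefore lies above a suitable member of [U]. *)
have upto_below g : below 0 (upto g (fun j _ => xi j) al) d.
  move=> h /uptoP [i [ci [_ hi]]].
  by rewrite (lsub_unique H hi (sgP i)); apply: sg_d.
have upto_sg g i : C al i -> ~ l3 g i -> upto g (fun j _ => xi j) al (sg i).
  by move=> ci gi; apply/uptoP; exists i.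
(* Here [g'] is to be the next element of [C al] after [g]. The point [u] is placed between a bound
   [b] of the limits up to [g] and the limit at [g'], with stage [m] witnessing both relations. *)
pose Q m g u := U u /\ lt u (xi g) /\ exists b g',
  below 0 (upto g (fun j _ => xi j) al) b /\ clos_trans K (Gam m) b u /\
  C al g' /\ (forall g2, C al g2 -> l3 g g2 -> ~ l3 g2 g') /\
  clos_trans K (Gam m) u (sg g').
(* A largest element of [C al], if there is one, has no next element and is dropped. *)
pose C' g := C al g /\ exists g', C al g' /\ l3 g g'.
have [mu muP] : exists mu : W3 -> nat * K, forall g, C' g -> Q (fst (mu g)) g (snd (mu g)).
  apply: (choice (fun g p => C' g -> Q (fst p) g (snd p))) => g.
  case: (classic (C' g)) => [[cg exg]|n]; last by exists (0, d).
  have [g' [[cg' gg'] g'min]] := swo_least H3 exg.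
  have [b [u [bX [bu [Uu ub]]]]] := bfP (upto g (fun j _ => xi j) al, 0)
    (ex_intro _ d (upto_below g)).
  have uxi : lt u (xi g) := swo_trans H ub (proj2 (xiP g) al 0).
  have [n1' h1] := cover b u bu.
  have [n2' h2] := cover u (sg g') (swo_trans H uxi (proj1 (sgP g') g gg')).
  exists (n1' + n2', u) => _; split=> //; split=> //; exists b, g'; split=> //.
  split; first by apply: Gmono h1 => /=; lia.
  split=> //; split; first by move=> g2 c2 gg2; apply: g'min.
  by apply: Gmono h2 => /=; lia.
have sg_mu g : C' g -> lt (sg g) (snd (mu g)).
  move=> cg; have [_ [_ [b [_ [bX [bu _]]]]]] := muP g cg.
  apply: (swo_trans H) (Glt _ _ _ bu); apply: (Glt 0); apply: bX.
  by apply: upto_sg; [apply: (proj1 cg)|apply: swo_irr].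
have mu_lt g g' : C' g -> C' g' -> l3 g g' -> lt (snd (mu g)) (snd (mu g')).
  move=> cg cg' gg'; have [_ [h _]] := muP g cg.
  apply: (swo_trans H) h _; apply: (swo_trans H) (sg_mu g' cg').
  exact: (proj1 (sgP g')).
(* Countably many stages serve uncountably many indices, so one stage serves uncountably many. *)
have [m bigm] : exists m, ~ card_le {g | C' g /\ fst (mu g) = m} nat.
  apply: NNPP => none; apply: unc.
  have le m : card_le {g | C' g /\ fst (mu g) = m} nat.
    by apply: NNPP => n; apply: none; exists m.
  have leC' : card_le {g | C' g} nat.
    apply: card_le_trans (card_le_bigcup (card_le_refl nat)
      (card_le_sig (fun _ : nat => True)) (fun m _ => le m)).
    by apply: card_le_subset => g cg; exists (fst (mu g)).
  case: (classic (exists g0, C al g0 /\ ~ C' g0)) => [[g0 [c0 n0]]|nomax].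
    apply: card_le_trans (card_le_add_point g0 (card_le_refl nat) leC').
    apply: card_le_subset => g cg; case: (swo_total H3 g g0) => [gg0|[|g0g]]; [|by right|].
      by left; split=> //; exists g0.
    by case: n0; split=> //; exists g.
  apply: card_le_trans leC'; apply: card_le_subset => g cg.
  by apply: NNPP => n; apply: nomax; exists g.
exists m, (fun b => exists g, C' g /\ fst (mu g) = m /\ snd (mu g) = b).
split; first by move=> b [g [cg [_ <-]]]; apply: (proj1 (muP g cg)).
split.
  move=> le; apply: bigm; apply: card_le_trans le.
  apply: (@card_le_rel _ _ (fun g b => snd (mu (proj1_sig g)) = proj1_sig b)).
    move=> [g [cg E]].
    by exists (exist _ (snd (mu g)) (ex_intro _ g (conj cg (conj E erefl)))).
  move=> [g [cg E]] [g' [cg' E']] [b hb] /= e1 e2; apply: subset_eq_compat.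
  case: (swo_total H3 g g') => [l|[//|l]].
    by have := mu_lt _ _ cg cg' l; rewrite e1 e2 => /(swo_irr H).
  by have := mu_lt _ _ cg' cg l; rewrite e1 e2 => /(swo_irr H).
move=> b b' [g [cg [E <-]]] [g' [cg' [E' <-]]] bb'.
have gg' : l3 g g'.
  case: (swo_total H3 g g') => [//|[Eg|l]].
    by case: (swo_irr (x := snd (mu g)) H); rewrite {2}Eg.
  by case: (swo_irr (x := snd (mu g)) H); apply: (swo_trans H) bb' (mu_lt _ _ cg' cg l).
(* Three links are composed: from the first point to the limit at the element [g1] following [g],
   from there to the bound [b2] of all limits up to [g'], and on to the second point. The middle
   link exists because [g1] is at most [g']. *)
have [_ [_ [_ [g1 [_ [_ [cg1 [g1min h1]]]]]]]] := muP g cg.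
have [_ [_ [b2 [_ [bX [h2 _]]]]]] := muP g' cg'.
rewrite E in h1; rewrite E' in h2.
apply: (t_trans _ _ _ _ _ h1); apply: (t_trans _ _ _ _ _ _ h2).
apply: (@Gmono 0); first lia.
apply: bX; apply: upto_sg => //; apply: g1min => //; exact: (proj1 cg').
Qed.

(** * Initial segments of branches and the comparability graph *)

Lemma finite_sig (T : Type) (P : T -> Prop) (l : list T) :
  (forall x, P x -> In x l) -> finite_type {x | P x}.
Proof.
move=> inl.
exists (flat_map (fun x => match excluded_middle_informative (P x) with
  | left p => exist _ x p :: nil | right _ => nil end) l) => [[x p]].
apply/in_flat_map; exists x; split; first exact: inl.
by case: excluded_middle_informative => // q; left; apply: subset_eq_compat.
Qed.

Lemma infinite_of_unbounded (T : Type) (h : T -> nat) :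
  (forall n, exists x, n <= h x) -> infinite_type T.
Proof.
move=> unb [l all].
have [N NP] : exists N, forall x, In x l -> h x < N.
  elim: l {all} => [|y l [N NP]]; first by exists 0.
  exists (S (h y) + N) => x /= [<-|/NP]; lia.
by have [x hx] := unb N; have := NP x (all x); lia.
Qed.

Lemma prefix_of_map (L : Type) (f : nat -> L) n : prefix_of (map f (seq 0 n)) f.
Proof. by rewrite /prefix_of length_map length_seq. Qed.

Lemma prefix_of_agree (L : Type) (s : list L) (f f' : nat -> L) n :
  prefix_of s f -> prefix_of s f' -> n < length s -> f n = f' n.
Proof.
move=> pf pf' ns; apply: (ext_in_map (l := seq 0 (length s))); first by rewrite -pf.
by apply/in_seq; lia.
Qed.

(** A branch has one initial segment of each length, so only finitely many have length at most
    [n]. *)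
Lemma long_prefix (L : Type) (P : list L -> Prop) (f : nat -> L) n :
  infinite_type {s | P s} -> (forall s, P s -> prefix_of s f) ->
  exists s, P s /\ n < length s.
Proof.
move=> inf pre; apply: NNPP => none; apply: inf.
apply: (@finite_sig _ _ (map (fun k => map f (seq 0 k)) (seq 0 (S n)))) => s Ps.
apply/in_map_iff; exists (length s); split; first by rewrite -(pre s Ps).
apply/in_seq; suff : ~ n < length s by lia.
by move=> h; apply: none; exists s.
Qed.

Definition comparability_graph (L : Type) (X : (nat -> L) -> Prop) (u v : tnode L) : Prop :=
  downclosure X u /\ downclosure X v /\ (tlt u v \/ tlt v u).

Lemma tlt_irrefl (L : Type) (u : tnode L) : ~ tlt u u.
Proof.
case: u => [s|f] //= [w [nw E]]; apply: nw; apply: (app_inv_head s).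
by rewrite app_nil_r.
Qed.

Lemma downclosure_tlt (L : Type) (X : (nat -> L) -> Prop) (s t : tnode L) :
  downclosure X t -> tlt s t -> downclosure X s.
Proof.
case: s => [s|//]; case: t => [t|f] /=; last by move=> Xf p; exists f.
move=> [f [Xf p]] [w [_ E]]; exists f; split=> //; move: p; rewrite E /prefix_of.
rewrite length_app seq_app map_app => eq_app.
have take_app (a b : list L) : firstn (length a) (a ++ b) = a.
  by rewrite firstn_app firstn_all PeanoNat.Nat.sub_diag app_nil_r.
rewrite -{1}(take_app s w) eq_app.
have {1}-> : length s = length (map f (seq 0 (length s))) by rewrite length_map length_seq.
exact: take_app.
Qed.

(** With all comparable pairs joined, cofinality below [t] is immediate: each [s] below [t] is
    itself a neighbour. *)
Lemma comparability_T_graph (L : Type) (X : (nat -> L) -> Prop) :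
  T_graph X (comparability_graph X).
Proof.
split; [|split; [|split; [|split]]].
- by move=> u v [hu [hv _]].
- by move=> u v [hu [hv h]]; split=> //; split=> //; tauto.
- by move=> u [_ [_ [|]]]; apply: tlt_irrefl.
- by move=> u v [_ [_ [h|h]]]; [left|right]; right.
- move=> t dt s st; exists s; split; first by left.
  by split=> //; split; [exact: downclosure_tlt st|split=> //; left].
Qed.

Lemma infinite_prefixes (L : Type) (X : (nat -> L) -> Prop) f :
  X f -> infinite_type {s | Tfin X s /\ Tedge (comparability_graph X) s f}.
Proof.
move=> Xf; apply: (@infinite_of_unbounded _ (fun s => length (proj1_sig s))) => n.
have pre := prefix_of_map f n.
have T : Tfin X (map f (seq 0 n)) by exists f.
have E : Tedge (comparability_graph X) (map f (seq 0 n)) f.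
  by split=> //; split=> //; left.
exists (exist (fun t => Tfin X t /\ Tedge (comparability_graph X) t f) _ (conj T E)).
by rewrite /= length_map length_seq.
Qed.

Lemma card_le_surjection (L K : Type) :
  inhabited L -> card_le L K -> exists s : K -> L, forall x, exists a, s a = x.
Proof.
move=> [x0] [i inj].
have [s sP] : exists s : K -> L, forall a x, i x = a -> x = s a.
  apply: (choice (fun a y => forall x, i x = a -> x = y)) => a.
  case: (classic (exists x, i x = a)) => [[x E]|none]; last first.
    by exists x0 => x E; case: none; exists x.
  by exists x => y E'; apply: inj; rewrite E.
by exists s => x; exists (i x); rewrite -(sP (i x) x).
Qed.

Theorem theorem7p1 :
  forall (L K : Type),
    singular_countable_cof L ->
    is_successor_card L K ->
    exists (X : (nat -> L) -> Prop) (G : tnode L -> tnode L -> Prop),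
      graph_of_type_T K X G /\
      ~ has_aleph0_subgraph K (Tfin X) X (Tedge G).
Proof.
move=> L K sing [[LK KL] dich].
have infL : card_le nat L by case: (card_le_total nat L) => // /(proj1 sing).
have [lt so] : exists lt : K -> K -> Prop, successor_order L lt.
  have [P [lt so]] := successor_order_exists infL KL.
  apply: (successor_order_pullback so KL).
  (* The subset [P] is too large to inject into [L], so the dichotomy for subsets of [K] makes it as
     large as [K]. *)
  by case: (dich P) => // /(so_big so).
have H := so_wo so.
have [A [Alt [Asmall [Acov Achain]]]] := uncountable_chains sing so.
have [g gP] : exists g : nat -> K -> L, forall n b a, A n b a -> g n b <> g n a.
  apply: (choice (fun n (g : K -> L) => forall b a, A n b a -> g b <> g a)) => n.
  apply: greedy_coloring (Asmall n).
  by apply: (wf_incl _ _ lt) (swo_wf H) => b a; apply: Alt.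
have inhL : inhabited L by case: infL => i _; exists; exact: i 0.
have [s sP] := card_le_surjection inhL LK.
(* the first coordinate makes every element of [L] occur in the tree *)
pose F a n := match n with 0 => s a | S m => g m a end.
have F_sep n b a : A n b a -> F b (S n) <> F a (S n) by apply: gP.
have F_inj b a : F b = F a -> b = a.
  move=> E; case: (swo_total H b a) => [/Acov [n]|[//|/Acov [n]]] /F_sep; by rewrite E.
pose X f := exists a, f = F a.
exists X, (comparability_graph X).
have XK : card_eq {f | X f} K.
  apply: card_le_anti.
    apply/card_le_setP; exists (fun f a => f = F a); split=> // f f' a _ _ -> //.
  by exists (fun a => exist X (F a) (ex_intro _ a erefl)) => b a [/F_inj].
have TL : card_eq {t | Tfin X t} L.
  apply: card_le_anti; first exact: card_le_trans (card_le_sig _) (card_le_list infL).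
  have T1 x : Tfin X (x :: nil).
    by have [a <-] := sP x; exists (F a); split=> //; exists a.
  by exists (fun x => exist (Tfin X) (x :: nil) (T1 x)) => x y [].
split.
  split=> //; split; first exact: comparability_T_graph.
  by split=> //; split=> // f; apply: infinite_prefixes.
move=> [C [D [E' [_ [DX [E'E [[c [c' [cK _]]] [[e [e' [_ eK]]] infE]]]]]]]].
have pre f t : E' t f -> prefix_of t f.
  by move=> /E'E [_ [_ [//|]]].
have bigU : ~ card_le {a | D (F a)} L.
  move=> le; apply: KL; apply: card_le_trans le.
  apply: (@card_le_rel _ _ (fun k a => F (proj1_sig a) = proj1_sig (e' k))).
    move=> k; case: (e' k) => f Df; have [a Ea] := DX f Df; subst f.
    by exists (exist _ a Df).
  move=> k k' [a Da] /= E1 E2; rewrite -(eK k) -(eK k'); congr e.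
  case: (e' k) (e' k') E1 E2 => f p [f' p'] /= E1 E2.
  by apply: subset_eq_compat; rewrite -E1.
have [n [B [BU [Bunc Bch]]]] := Achain _ bigU.
apply: Bunc; apply/card_le_setP.
(* Each [b] is assigned the number of a node of [C] on [F b] that is long enough to contain
   coordinate [S n]. Points sharing a node agree at that coordinate, which [F_sep] forbids for
   distinct points of the chain; so [B] would be countable. *)
exists (fun b m => exists t (p : C t), prefix_of t (F b) /\ S n < length t /\
  c (exist _ t p) = m); split.
  move=> b Bb; have Db := BU b Bb.
  have [|t [[Ct Et] nt]] := long_prefix (f := F b) (S n) (infE _ Db); first by move=> t [_ /pre].
  by exists (c (exist _ t Ct)), t, Ct; split; first exact: (pre _ _ Et).
move=> b b' m Bb Bb' [t [p [pt [nt Em]]]] [t' [p' [pt' [_ Em']]]].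
have [Et] : exist C t p = exist C t' p' by rewrite -(cK (exist C t p)) Em -Em' cK.
subst t'; have Fn := prefix_of_agree pt pt' nt.
case: (swo_total H b b') => [l|[//|l]].
  by case: (F_sep n b b' (Bch _ _ Bb Bb' l)).
by case: (F_sep n b' b (Bch _ _ Bb' Bb l)).
Qed.
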